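(* Let $K\in\mathcal L(\mathcal H)$ and let $\mathcal W=\{(W_i,w_i)\}_{i\in I}$ be a Bessel fusion sequence in $\mathcal H$ with frame operator $S_{\mathcal W}$. Then $\mathcal W$ is an atomic system for $K$ if and only if the quotient operator $[K^*/S_{\mathcal W}^{1/2}]$ is bounded.
   Context: $\mathcal H$ is a separable Hilbert space, $\mathcal L(\mathcal H)$ is the space of bounded linear operators on $\mathcal H$, and $I$ is a countable index set. For a closed subspace $W$, $\pi_W$ denotes the orthogonal projection onto $W$; $R(\cdot)$ and $N(\cdot)$ denote range and kernel. A family $\mathcal W=\{(W_i,w_i)\}_{i\in I}$ of closed subspaces $W_i$ of $\mathcal H$ with weights $w_i>0$ is a Bessel fusion sequence if there is $B<\infty$ with $\sum_{i\in I}w_i^2\|\pi_{W_i}f\|^2\le B\|f\|^2$ for all $f\in\mathcal H$. Its frame operator is the bounded positive operator $S_{\mathcal W}f=\sum_{i\in I}w_i^2\pi_{W_i}(f)$. Put $\big(\sum_{i\in I}\oplus W_i\big)_{\ell^2}=\{\{a_i\}_{i\in I}: a_i\in W_i,\ \sum_{i\in I}\|a_i\|^2<\infty\}$ with inner product $\langle\{a_i\},\{c_i\}\rangle=\sum_{i\in I}\langle a_i,c_i\rangle$. $\mathcal W$ is an atomic system for $K$ if (a) $\mathcal W$ is a Bessel fusion sequence, and (b) there is $C>0$ such that for every $f\in\mathcal H$ there exists $\{a_i\}_{i\in I}\in\big(\sum_{i\in I}\oplus W_i\big)_{\ell^2}$ with $\|\{a_i\}\|\le C\|f\|$ and $Kf=\sum_{i\in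 I}w_ia_i$. For $U,V\in\mathcal L(\mathcal H)$ with $N(V)\subset N(U)$, the quotient $[U/V]$ is the linear map $R(V)\to R(U)$, $Vf\mapsto Uf$; it is well defined exactly when $N(V)\subset N(U)$, and saying that $[U/V]$ is bounded includes that it is well defined. *)

(* Defs.v *)
From HB Require Import structures.
From mathcomp Require Import all_boot all_order all_algebra.
From mathcomp Require Import sesquilinear.
From mathcomp Require Import finmap complex.
From mathcomp Require Import all_classical all_reals.
From mathcomp Require Import ereal topology normedtype sequences esum.
From mathcomp Require summability.

Set Implicit Arguments.
Unset Strict Implicit.
Unset Printing Implicit Defensive.

Import Order.TTheory GRing.Theory Num.Theory.
Import numFieldNormedType.Exports.

Local Open Scope classical_set_scope.
Local Open Scope ring_scope.

(* Hilbert spaces over R and over C = R[i] are treated together: the scalar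
   field is [scalar R k], where k says which of the two it is. *)
Variant scalar_kind := RealScalars | ComplexScalars.

Definition scalar (R : realType) (k : scalar_kind) : numFieldType :=
  match k with
  | RealScalars => R
  | ComplexScalars => R[i]
  end.

Definition of_real {R : realType} {k : scalar_kind} : R -> scalar R k :=
  match k with
  | RealScalars => fun x => x
  | ComplexScalars => fun x => Complex x 0
  end.

Definition re {R : realType} {k : scalar_kind} : scalar R k -> R :=
  match k with
  | RealScalars => fun z => z
  | ComplexScalars => fun z => complex.Re z
  end.

Definition conj {R : realType} {k : scalar_kind} : scalar R k -> scalar R k :=
  match k with
  | RealScalars => fun z => z
  | ComplexScalars => fun z => conjc z
  end.

(* [inner] is linear in its first argument and conjugate-linear in the
   second one. *)
HB.mixin Record isHilbert (R : realType) (k : scalar_kind) H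
    of CompleteNormedModule (scalar R k) H := {
  inner : {dot H for @conj R k} ;
  inner_norm : forall x : H, inner x x = `|x| ^+ 2
}.

#[short(type="hilbertType")]
HB.structure Definition Hilbert (R : realType) (k : scalar_kind) :=
  {H of CompleteNormedModule (scalar R k) H & isHilbert R k H}.

Definition separable (T : topologicalType) :=
  exists2 D : set T, countable D & dense D.

Section HilbertOperators.
Context {R : realType} {k : scalar_kind} {H : hilbertType R k}.
Implicit Types (T U V : H -> H) (W : set H).

Local Notation "''[' x , y ]" := (@inner R k H x y).

(* The library norm takes its values in the scalar field, i.e. in R[i] for a
   complex space. *)
Definition hnorm (x : H) : R := re `|x|.

Definition bounded_operator T :=
  linear T /\ exists M : R, forall x, hnorm (T x) <= M * hnorm x.

Definition adjoint T : H -> H :=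
  xget (fun=> 0)
    [set T' | bounded_operator T' /\ forall x y, '[T x, y] = '[x, T' y]].

(* Self-adjointness is not a consequence of the other two clauses when the
   scalars are real. *)
Definition positive_operator T :=
  [/\ bounded_operator T,
      (forall x y, '[T x, y] = '[x, T y]) &
      (forall x, 0 <= '[T x, x])].

Definition sqrt_operator T : H -> H :=
  xget (fun=> 0) [set Q | positive_operator Q /\ Q \o Q = T].

Definition closed_subspace W :=
  [/\ closed W, W 0 &
      forall (a : scalar R k) x y, W x -> W y -> W (a *: x + y)].

Definition proj W (x : H) : H :=
  xget 0 [set p | W p /\ forall y, W y -> '[x - p, y] = 0].

(* Outside of [range V] the value is meaningless; it depends on the choice of
   a preimage unless N(V) is included in N(U). *)
Definition quotient U V (y : H) : H := U (xget 0 [set x | V x = y]).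

Definition bounded_quotient U V :=
  [set x | V x = 0] `<=` [set x | U x = 0] /\
  exists M : R, forall y, range V y -> hnorm (quotient U V y) <= M * hnorm y.

End HilbertOperators.

Section FusionSequences.
Context {R : realType} {k : scalar_kind} {H : hilbertType R k} {I : countType}.
Implicit Types (W : I -> set H) (w : I -> R) (a : I -> H) (K : H -> H).

Definition bessel_fusion_sequence W w :=
  [/\ (forall i, closed_subspace (W i)),
      (forall i, 0 < w i) &
      exists B : R, forall f : H,
        (\esum_(i in [set: I]) (w i ^+ 2 * hnorm (proj (W i) f) ^+ 2)%:E
           <= (B * hnorm f ^+ 2)%:E)%E].

(* The index set carries no order, so vector-valued series are limits along
   the directed set of finite subsets of I. *)
Definition frame_operator W w (f : H) : H :=
  summability.sum (fun i => of_real (w i ^+ 2) *: proj (W i) f).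

Definition has_sum (u : I -> H) (s : H) :=
  summability.partial_sum u @ summability.totally --> s.

Definition l2_sum W : set (I -> H) :=
  [set a | (forall i, W i (a i)) /\
           (\esum_(i in [set: I]) (hnorm (a i) ^+ 2)%:E < +oo)%E].

Definition l2_norm a : R :=
  Num.sqrt (fine (\esum_(i in [set: I]) (hnorm (a i) ^+ 2)%:E)%E).

Definition atomic_system K W w :=
  bessel_fusion_sequence W w /\
  exists2 C : R, 0 < C &
    forall f : H, exists a : I -> H,
      [/\ l2_sum W a,
          l2_norm a <= C * hnorm f &
          has_sum (fun i => of_real (w i) *: a i) (K f)].

End FusionSequences.

(* Main.v *)
From mathcomp Require Import all_boot all_order all_algebra.
From mathcomp Require Import all_classical all_reals.
From mathcomp Require Import ring lra.
From mathcomp Require Import sesquilinear finmap complex.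
From mathcomp Require Import ereal topology normedtype esum.
From mathcomp Require summability.
Require Import Defs.

(**
Let [T_i f = w_i pi_{W_i} f] be the coordinates of the analysis operator, so
that [S f = sum_i w_i T_i f] and [|S^{1/2} g|^2 = <S g, g> = sum_i |T_i g|^2].
Boundedness of the quotient [[K^* / S^{1/2}]] means exactly that
[|K^* g| <= M |S^{1/2} g|] for all [g] (lemma [bounded_quotientP]).

If the system is atomic for [K], write [K f = sum_i w_i a_i] with
[f = K^* g] and [|a| <= C |f|].  Then
[|K^* g|^2 = <K f, g> = sum_i <a_i, T_i g> <= C |K^* g| |S^{1/2} g|]
by Cauchy-Schwarz, which is the domination (lemma
[atomic_system_dominated]).

Conversely, assume the domination and fix [f].  The functional
[l v = Re <K f, v> = Re <f, K^* v>] satisfies [|l v| <= M |f| |S^{1/2} v|], so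
[<S u, u> - 2 l u] is bounded below; almost minimising it gives vectors
[u_n] with [|Re <S u_n, v> - l v| <= |S^{1/2} v| / (n + 1)] for all [v] (lemma
[approx_representation]).  These need not converge, but they are Cauchy for
the form of [S]; hence the families [(T_i u_n)_i] are Cauchy in l^2, their
coordinatewise limit [a] has norm at most [M |f|], and synthesising gives
[sum_i w_i a_i = lim S u_n = K f] (lemma [dominated_atomic_system]).

Projections and adjoints come from the same approximate representation,
applied to the inner product, followed by completeness.  The square root of
a positive operator comes from the fixed point of [Z = (A + Z^2) / 2], where
[A = 1 - S / N], whose iterates are dominated by those of the scalar
recursion [y = (1 + y^2) / 2].  Only its existence matters, since every
positive [Q] with [Q^2 = S] satisfies [|Q g|^2 = <S g, g>].

All estimates are made with the real part of the inner product, which treats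
real and complex scalars alike; full inner products are recovered by
[inner_ip_ext].
*)

Set Implicit Arguments.
Unset Strict Implicit.
Unset Printing Implicit Defensive.

Import Order.TTheory GRing.Theory Num.Theory.
Import numFieldNormedType.Exports.

Local Open Scope classical_set_scope.
Local Open Scope ring_scope.

(** * Real and complex scalars *)

Section Scalars.
Context {R : realType} {k : scalar_kind}.
Implicit Types (c d : R) (z : scalar R k).
Local Notation toK := (@of_real R k).

Lemma of_realD c d : toK (c + d) = toK c + toK d.
Proof. by rewrite /of_real; case: k => //; simpc. Qed.

Lemma of_realM c d : toK (c * d) = toK c * toK d.
Proof. by rewrite /of_real; case: k => //; simpc. Qed.

Lemma of_real0 : toK 0 = 0.
Proof. by rewrite /of_real; case: k. Qed.

Lemma of_real1 : toK 1 = 1.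
Proof. by rewrite /of_real; case: k. Qed.

Lemma of_realN c : toK (- c) = - toK c.
Proof. by rewrite /of_real; case: k => //; simpc. Qed.

Lemma of_realX c n : toK (c ^+ n) = toK c ^+ n.
Proof. by elim: n => [|n IH]; rewrite ?of_real1 // !exprS of_realM IH. Qed.

Lemma of_real_le c d : (toK c <= toK d) = (c <= d).
Proof. by rewrite /of_real; case: k => //; simpc; rewrite ?eqxx. Qed.

Lemma of_real_lt c d : (toK c < toK d) = (c < d).
Proof. by rewrite /of_real; case: k => //; simpc; rewrite ?eqxx. Qed.

Lemma reK c : re (toK c) = c.
Proof. by rewrite /of_real /re; case: k. Qed.

Lemma of_real_re z : 0 <= z -> toK (re z) = z.
Proof.
rewrite /of_real /re; case: k z => // -[a b].
by rewrite lecE /= => /andP[/eqP -> _].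
Qed.

Lemma of_real_norm c : `|toK c| = toK `|c|.
Proof.
have [c0|c0] := leP 0 c; first by rewrite !ger0_norm // -of_real0 of_real_le.
by rewrite !ltr0_norm ?of_realN // -of_real0 of_real_lt.
Qed.

Lemma reD z1 z2 : re (z1 + z2) = re z1 + re z2.
Proof. by rewrite /re; case: k z1 z2 => // -[? ?] [? ?]. Qed.

Lemma reZ c z : re (toK c * z) = c * re z.
Proof.
by rewrite /re /of_real; case: k z => // -[? ?]; simpc.
Qed.

Lemma re_conj z : re (conj z) = re z.
Proof. by rewrite /re /conj; case: k z => // -[]. Qed.

Lemma conjK z : conj (conj z) = z.
Proof. by rewrite /conj; case: k z => // z; exact: conjcK. Qed.

(** A scalar is determined by the real parts of its multiples; this recovers
    identities between inner products from identities between their real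
    parts. *)
Lemma scalar_ext z1 z2 : (forall a, re (a * z1) = re (a * z2)) -> z1 = z2.
Proof.
rewrite /re; case: k z1 z2 => [z1 z2 /(_ 1)|[a b] [c d] H].
  by rewrite !mul1r.
have := H 1; have := H (Complex 0 1); simpc.
by rewrite /= => /oppr_inj -> ->.
Qed.

(** For complex scalars [0 <= z] also says that [z] is real, hence the first
    hypothesis. *)
Lemma conj_fix_ge0 z : conj z = z -> 0 <= re z -> 0 <= z.
Proof.
rewrite /conj /re; case: k z => [z _ //|[a b] /= [bE] a0].
by rewrite lecE /= a0 andbT; apply/eqP; lra.
Qed.

End Scalars.

(** * The real inner product and the norm *)

Section InnerProduct.
Context {R : realType} {k : scalar_kind} {H : hilbertType R k}.
Implicit Types (c : R) (x y z : H) (a : scalar R k).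
Local Notation toK := (@of_real R k).
Local Notation "''[' x , y ]" := (@inner R k H x y).

Lemma inner_sym x y : '[x, y] = conj '[y, x].
Proof.
by have := @hermitian_subproof _ _ _ _ (@inner R k H) x y; rewrite expr0 mul1r.
Qed.

Lemma inner_addl x y z : '[x + y, z] = '[x, z] + '[y, z].
Proof. exact: linearDl. Qed.

Lemma inner_scalel a x y : '[a *: x, y] = a * '[x, y].
Proof. exact: linearZl_LR. Qed.

Lemma inner_scaler a x y : '[x, a *: y] = conj a * '[x, y].
Proof. exact: linearZr_LR. Qed.

(** The real inner product underlying a real or complex Hilbert space. *)
Definition ip x y : R := re '[x, y].

Lemma ipC x y : ip x y = ip y x.
Proof. by rewrite /ip inner_sym re_conj. Qed.

Lemma ipDl x y z : ip (x + y) z = ip x z + ip y z.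
Proof. by rewrite /ip inner_addl reD. Qed.

Lemma ipZl c x y : ip (toK c *: x) y = c * ip x y.
Proof. by rewrite /ip inner_scalel reZ. Qed.

Lemma ipNl x y : ip (- x) y = - ip x y.
Proof. by rewrite -scaleN1r -of_real1 -of_realN ipZl mulN1r. Qed.

Lemma ipBl x y z : ip (x - y) z = ip x z - ip y z.
Proof. by rewrite ipDl ipNl. Qed.

Lemma ip0l x : ip 0 x = 0.
Proof. by rewrite -(scale0r 0) -of_real0 ipZl mul0r. Qed.

Lemma ipDr x y z : ip z (x + y) = ip z x + ip z y.
Proof. by rewrite !(ipC z) ipDl. Qed.

Lemma ipZr c x y : ip y (toK c *: x) = c * ip y x.
Proof. by rewrite !(ipC y) ipZl. Qed.

Lemma ipBr x y z : ip z (x - y) = ip z x - ip z y.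
Proof. by rewrite !(ipC z) ipBl. Qed.

Lemma ip_scaleA a x y : ip (a *: x) y = ip x (conj a *: y).
Proof. by rewrite /ip inner_scalel inner_scaler conjK. Qed.

Lemma ip_suml (J : Type) (r : seq J) (P : pred J) (u : J -> H) x :
  ip (\sum_(j <- r | P j) u j) x = \sum_(j <- r | P j) ip (u j) x.
Proof.
by apply: (big_morph (fun y => ip y x)) => [y z|]; rewrite ?ipDl ?ip0l.
Qed.

Lemma of_real_hnorm x : toK (hnorm x) = `|x|.
Proof. exact: of_real_re. Qed.

Lemma hnorm_ge0 x : 0 <= hnorm x.
Proof. by rewrite -(of_real_le (k := k)) of_real_hnorm of_real0. Qed.

Lemma ipxx x : ip x x = hnorm x ^+ 2.
Proof. by rewrite /ip inner_norm -of_real_hnorm -of_realX reK. Qed.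

Lemma hnorm_eq0 x : hnorm x = 0 -> x = 0.
Proof. by move=> h; apply/normr0_eq0; rewrite -of_real_hnorm h of_real0. Qed.

Lemma hnorm0 : hnorm (0 : H) = 0.
Proof. by rewrite /hnorm normr0 -of_real0 reK. Qed.

Lemma hnormD x y : hnorm (x + y) <= hnorm x + hnorm y.
Proof.
by rewrite -(of_real_le (k := k)) of_realD !of_real_hnorm ler_normD.
Qed.

Lemma hnormN x : hnorm (- x) = hnorm x.
Proof. by rewrite /hnorm normrN. Qed.

Lemma hnormBC x y : hnorm (x - y) = hnorm (y - x).
Proof. by rewrite -hnormN opprB. Qed.

Lemma hnormZ c x : hnorm (toK c *: x) = `|c| * hnorm x.
Proof. by rewrite /hnorm normrZ of_real_norm reZ. Qed.

Lemma ip_inj x y : (forall z, ip x z = ip y z) -> x = y.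
Proof.
move=> h; apply/eqP; rewrite -subr_eq0; apply/eqP/hnorm_eq0/eqP.
by rewrite -sqrf_eq0 -ipxx ipBl h subrr.
Qed.

(** Real parts determine inner products; [a] ranges over all scalars. *)
Lemma inner_ip_ext x y x' y' :
  (forall a, ip (a *: x) y = ip (a *: x') y') -> '[x, y] = '[x', y'].
Proof.
by move=> h; apply: scalar_ext => a; rewrite -!inner_scalel; exact: h.
Qed.

End InnerProduct.

(** * Convergence in norm *)

Section Convergence.
Context {R : realType} {k : scalar_kind} {H : hilbertType R k}.

(** Convergence and Cauchy filters, with real-valued norms and radii. *)
Lemma hcvgP (T : Type) (F : set_system T) (FF : Filter F) (f : T -> H) (l : H) :
  f @ F --> l <->
  forall e : R, 0 < e -> \forall t \near F, hnorm (l - f t) < e.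
Proof.
split=> [/cvgrPdist_lt fl e e0|fl].
  have := fl (of_real e); rewrite -of_real0 of_real_lt => /(_ e0).
  apply: filterS => t.
  by rewrite -of_real_hnorm of_real_lt.
apply/cvgrPdist_lt => e e0.
have eE := of_real_re (ltW e0).
have {}e0 : 0 < re e by rewrite -(of_real_lt (k := k)) eE of_real0.
have := fl _ e0; apply: filterS => t.
by rewrite -(of_real_lt (k := k)) eE of_real_hnorm.
Qed.

Lemma hcauchy_cvg (T : Type) (F : set_system T) (FF : ProperFilter F)
    (f : T -> H) :
  (forall e : R, 0 < e -> exists x, \forall t \near F, hnorm (x - f t) < e) ->
  exists l : H, f @ F --> l.
Proof.
move=> h; exists (lim (f @ F)); apply: cauchy_cvg; apply: cauchy_exP => e e0.
have eE := of_real_re (ltW e0).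
have {}e0 : 0 < re e by rewrite -(of_real_lt (k := k)) eE of_real0.
have [x hx] := h _ e0; exists x; move: hx; apply: filterS => t.
by rewrite -ball_normE /= -(of_real_lt (k := k)) eE of_real_hnorm.
Qed.

Lemma hcvg_unique (T : Type) (F : set_system T) (FF : ProperFilter F)
    (f : T -> H) (x y : H) : f @ F --> x -> f @ F --> y -> x = y.
Proof. exact: norm_cvg_unique. Qed.

End Convergence.

(** * Positive forms and approximate representation of functionals *)

Section RealEstimates.
Context {R : realType}.
Implicit Types (b c e : R).

Lemma discriminant_le c b Q : 0 <= Q ->
  (forall t, 0 <= c + 2 * t * b + t ^+ 2 * Q) -> b ^+ 2 <= c * Q.
Proof.
move=> Q0 h; have c0 : 0 <= c by have := h 0; rewrite !expr2; lra.
have [Qz|Qn0] := eqVneq Q 0.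
  rewrite Qz mulr0; have [->|bn0] := eqVneq b 0; first by rewrite expr0n.
  (* The polynomial is affine, and takes the value -1 at this point. *)
  have := h (- (c + 1) / (2 * b)); rewrite Qz mulr0 addr0.
  have -> : c + 2 * (- (c + 1) / (2 * b)) * b = - 1 by field.
  lra.
have Qp : 0 < Q by rewrite lt_def Qn0.
(* The minimum of the quadratic polynomial in [t]. *)
have := h (- b / Q).
have -> : c + 2 * (- b / Q) * b + (- b / Q) ^+ 2 * Q = (c * Q - b ^+ 2) / Q.
  by field.
by rewrite pmulr_lge0 ?invr_gt0 //; lra.
Qed.

Lemma sqr_le_norm_sqrt b c e : 0 <= e -> b ^+ 2 <= e ^+ 2 * c ->
  `|b| <= e * Num.sqrt c.
Proof.
move=> e0 h; rewrite -sqrtr_sqr -[e in leRHS]ger0_norm // -sqrtr_sqr.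
by rewrite -sqrtrM ?sqr_ge0 // ler_wsqrtr.
Qed.

(** Cancels one power of a nonnegative quantity that may vanish. *)
Lemma le_mul_self b c : 0 <= b -> 0 <= c -> b ^+ 2 <= c * b -> b <= c.
Proof.
move=> b0 c0; have [->//|bn0] := eqVneq b 0.
by rewrite expr2 ler_pM2r // lt_def bn0.
Qed.

Lemma inv_succ_lt e : 0 < e -> exists n, n.+1%:R^-1 < e.
Proof.
move=> e0; have [n _ hn] := near_infty_natSinv_lt (PosNum e0).
by exists n; exact: (hn n (leqnn n)).
Qed.

Lemma le0_vanishing (r : nat -> R) b c : 0 <= c ->
  (forall d, 0 < d -> exists n, r n < d) -> (forall n, b <= c * r n) -> b <= 0.
Proof.
move=> c0 r0 h; rewrite leNgt; apply/negP => b0.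
have {}c0 : 0 < c.
  rewrite lt_def c0 andbT; apply/eqP => cE.
  by have := h 0; rewrite cE mul0r leNgt b0.
have [n hn] := r0 _ (divr_gt0 b0 c0).
have := h n; rewrite leNgt => /negP; apply.
by rewrite mulrC -ltr_pdivlMr.
Qed.

End RealEstimates.

Section PositiveForms.
Context {R : realType} {k : scalar_kind} {H : hilbertType R k}.
Implicit Types (x y u v : H) (q : H -> H -> R) (D : set H) (l : H -> R).
Local Notation toK := (@of_real R k).

(** A positive semidefinite symmetric form, bilinear over the reals. *)
Definition psd_form q :=
  [/\ forall x y, q x y = q y x,
      forall x y z, q (x + y) z = q x z + q y z,
      forall c x y, q (toK c *: x) y = c * q x y &
      forall x, 0 <= q x x].

Lemma psd_ip : psd_form (@ip R k H).
Proof.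
split; [exact: ipC|exact: ipDl|exact: ipZl|].
by move=> x; rewrite ipxx sqr_ge0.
Qed.

Lemma psd_form_expand q x y (c : R) : psd_form q ->
  q (x + toK c *: y) (x + toK c *: y) = q x x + 2 * c * q x y + c ^+ 2 * q y y.
Proof.
case=> qC qD qZ _.
rewrite qD qZ !(qC _ (x + _)) !qD !qZ (qC y x) expr2; ring.
Qed.

Lemma psd_formB q x y z : psd_form q -> q (x - y) z = q x z - q y z.
Proof.
by case=> _ qD qZ _; rewrite qD -scaleN1r -of_real1 -of_realN qZ mulN1r.
Qed.

Lemma cauchy_schwarz q x y : psd_form q -> q x y ^+ 2 <= q x x * q y y.
Proof.
move=> qP; have [_ _ _ q0] := qP; apply: discriminant_le => // t.
by rewrite -psd_form_expand.
Qed.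

Lemma cauchy_schwarz_sqrt q x y : psd_form q ->
  `|q x y| <= Num.sqrt (q x x) * Num.sqrt (q y y).
Proof.
move=> qP; have [_ _ _ q0] := qP; apply: sqr_le_norm_sqrt (sqrtr_ge0 _) _.
by rewrite sqr_sqrtr // cauchy_schwarz.
Qed.

Lemma sqrt_ipxx x : Num.sqrt (ip x x) = hnorm x.
Proof. by rewrite ipxx sqrtr_sqr ger0_norm // hnorm_ge0. Qed.

Lemma ip_le x y : `|ip x y| <= hnorm x * hnorm y.
Proof. by rewrite -!sqrt_ipxx; apply: cauchy_schwarz_sqrt; exact: psd_ip. Qed.

Definition real_subspace D :=
  D 0 /\ forall x y (c : R), D x -> D y -> D (x + toK c *: y).

Definition real_linear l :=
  forall x y (c : R), l (x + toK c *: y) = l x + c * l y.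

(** Approximate form of the Riesz theorem: [u] almost minimises
    [q u u - 2 * l u] over [D].  No completeness is needed. *)
Lemma approx_representation q D l (M e : R) : psd_form q -> real_subspace D ->
  real_linear l -> (forall v, D v -> l v ^+ 2 <= M * q v v) -> 0 < e ->
  exists2 u, D u & forall v, D v -> `|q u v - l v| <= e * Num.sqrt (q v v).
Proof.
move=> qP [D0 DD] lP lM e0; have [qC qD qZ q0] := qP.
pose phi u := q u u - 2 * l u.
pose E := phi @` D.
have lbE : lbound E (- `|M|).
  move=> _ [u Du <-]; rewrite /phi.
  have M0 := normr_ge0 M; have qu := q0 u.
  have : l u ^+ 2 <= `|M| * q u u.
    by apply: le_trans (lM _ Du) _; rewrite ler_wpM2r // ler_norm.
  rewrite leNgt => lu; apply/negP => h.
  have : (q u u + `|M|) ^+ 2 < (2 * l u) ^+ 2.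
    by rewrite ltr_pXn2r ?nnegrE //; lra.
  by have := sqr_ge0 (q u u - `|M|); move: lu; rewrite !expr2; lra.
have infE : has_inf E by split; [exists (phi 0), 0|exists (- `|M|)].
(* Precision [e ^+ 2] in the infimum yields precision [e] on the functional. *)
have [_ [u Du <-] hu] := inf_adherent (exprn_gt0 2 e0) infE.
exists u => // v Dv; apply: sqr_le_norm_sqrt; first exact: ltW.
apply: discriminant_le => // t.
have : inf E <= phi (u + toK t *: v).
  by apply: ge_inf; [exact: infE.2|exists (u + toK t *: v) => //; exact: DD].
move: hu; rewrite /phi psd_form_expand // lP.
lra.
Qed.

(** Any two approximate representatives are close to each other. *)
Lemma approx_representation_close q D l (e1 e2 : R) u1 u2 :
  psd_form q -> D (u1 - u2) -> 0 <= e1 -> 0 <= e2 ->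
  (forall v, D v -> `|q u1 v - l v| <= e1 * Num.sqrt (q v v)) ->
  (forall v, D v -> `|q u2 v - l v| <= e2 * Num.sqrt (q v v)) ->
  Num.sqrt (q (u1 - u2) (u1 - u2)) <= e1 + e2.
Proof.
move=> qP Du e10 e20 /(_ _ Du) + /(_ _ Du); have [_ _ _ q0] := qP.
set s := Num.sqrt _ => h1 h2.
apply: le_mul_self; [exact: sqrtr_ge0|exact: addr_ge0|].
rewrite sqr_sqrtr // psd_formB // mulrDl.
move: h1 h2; rewrite !ler_norml => /andP[_ h1] /andP[h2 _].
lra.
Qed.

End PositiveForms.

(** * Projections and adjoints *)

Section Linear.
Context {R : realType} {k : scalar_kind} {H : hilbertType R k}.
Implicit Types (x y : H) (a : scalar R k).
Variables (T : H -> H) (Tlin : linear T).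

Lemma linD x y : T (x + y) = T x + T y.
Proof. by have := Tlin 1 x y; rewrite !scale1r. Qed.

Lemma lin0 : T 0 = 0.
Proof. by apply: (addrI (T 0)); rewrite -linD !addr0. Qed.

Lemma linZ a x : T (a *: x) = a *: T x.
Proof. by have := Tlin a x 0; rewrite lin0 !addr0. Qed.

Lemma linB x y : T (x - y) = T x - T y.
Proof. by rewrite linD -scaleN1r linZ scaleN1r. Qed.

End Linear.

Section Completeness.
Context {R : realType} {k : scalar_kind} {H : hilbertType R k}.
Implicit Types (x y u v : H).
Local Notation toK := (@of_real R k).

(** A Cauchy sequence with explicit modulus [e], together with the error
    estimate for its limit. *)
Lemma cauchy_seq_limit (u : nat -> H) (e : nat -> R) :
  (forall d, 0 < d -> exists n, e n < d) ->
  (forall n m, (n <= m)%N -> hnorm (u m - u n) <= e n) ->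
  exists2 l : H, u @ \oo --> l & forall n, hnorm (l - u n) <= e n.
Proof.
move=> e0 ue.
have [l ul] : exists l : H, u @ \oo --> l.
  apply: hcauchy_cvg => d /e0[n nd]; exists (u n); exists n => // m /= nm.
  by rewrite hnormBC; apply: le_lt_trans (ue _ _ nm) nd.
exists l => // n; apply/ler_addgt0Pr => d d0.
have /hcvgP/(_ _ d0)[m _ hm] := ul.
have := hnormD (l - u (maxn n m)) (u (maxn n m) - u n).
rewrite addrA subrK => /le_trans; apply; rewrite addrC lerD //.
  by apply: ue; exact: leq_maxl.
by apply/ltW/hm; exact: leq_maxr.
Qed.

(** In a complete space the approximate representatives converge. *)
Lemma approx_limit (D : set H) (l : H -> R) (M : R) : real_subspace D ->
  real_linear l -> (forall v, D v -> l v ^+ 2 <= M * ip v v) ->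
  exists u : nat -> H, exists p : H,
    [/\ forall n, D (u n), u @ \oo --> p &
        forall v, D v -> ip p v = l v].
Proof.
move=> DP lP lM.
have e0 n : 0 < n.+1%:R^-1 :> R by rewrite invr_gt0.
have /choice[u uP] n : exists u, D u /\
    forall v, D v -> `|ip u v - l v| <= n.+1%:R^-1 * hnorm v.
  have [u Du hu] := approx_representation psd_ip DP lP lM (e0 n).
  by exists u; split=> // v Dv; rewrite -sqrt_ipxx; exact: hu.
have Du n : D (u n) by have [] := uP n.
have uv n := (uP n).2.
have [||p up hp] := @cauchy_seq_limit u (fun n => 2 * n.+1%:R^-1).
- move=> d d0; have [|n hn] := @inv_succ_lt R (d / 2).
    by rewrite divr_gt0.
  by exists n; rewrite mulrC -ltr_pdivlMr.
- move=> n m nm; rewrite -sqrt_ipxx.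
  have DB : D (u m - u n).
    by rewrite -scaleN1r -of_real1 -of_realN; apply: DP.2.
  apply: le_trans (approx_representation_close (l := l) psd_ip DB
    (ltW (e0 m)) (ltW (e0 n)) _ _) _.
  + by move=> v Dv; rewrite sqrt_ipxx; exact: uv.
  + by move=> v Dv; rewrite sqrt_ipxx; exact: uv.
  + by rewrite mulr2n mulrDl !mul1r lerD2r lef_pV2 ?posrE // ler_nat.
exists u, p; split=> // v Dv; apply/eqP.
rewrite -subr_eq0 -normr_le0.
apply: (le0_vanishing (c := 3 * hnorm v) _ (@inv_succ_lt R)) => [|n].
  by rewrite mulr_ge0 ?hnorm_ge0.
have -> : ip p v - l v = ip (p - u n) v + (ip (u n) v - l v).
  by rewrite ipBl; ring.
apply: le_trans (ler_normD _ _) _.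
have := ip_le (p - u n) v; have := uv n v Dv; have /= := hp n.
move: (n.+1%:R^-1 : R) (hnorm_ge0 v) => e v0 h1 h2 h3.
have := ler_wpM2r v0 h1; lra.
Qed.

Lemma closed_subspace_real (W : set H) :
  closed_subspace W -> real_subspace W.
Proof.
by case=> _ W0 WP; split=> // x y c Wx Wy; rewrite addrC; exact: WP.
Qed.

Lemma real_linear_ip x : real_linear (ip x).
Proof. by move=> y z c; rewrite ipDr ipZr. Qed.

(** Orthogonal projections exist. *)
Lemma projP (W : set H) x : closed_subspace W ->
  W (proj W x) /\ forall y, W y -> inner (x - proj W x) y = 0.
Proof.
move=> WP; have [Wc W0 Wlin] := WP; rewrite /proj; apply: (@xgetPex _ 0
  [set p | W p /\ forall y, W y -> inner (x - p) y = 0]).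
have [v _|u [p [Wu up hp]]] := approx_limit (M := ip x x)
   (closed_subspace_real WP) (real_linear_ip x).
  by apply: cauchy_schwarz; exact: psd_ip.
exists p; split.
  by apply: (closed_cvg W Wc _ p up); apply: nearW.
move=> y Wy; rewrite -(linear0l (@inner R k H) y).
apply: inner_ip_ext => a; rewrite scaler0 ip0l ip_scaleA.
rewrite ipBl hp ?subrr //.
by rewrite -[_ *: _]addr0; apply: Wlin.
Qed.

(** Riesz representation, for the real inner product. *)
Lemma riesz (l : H -> R) (M : R) : real_linear l ->
  (forall v, `|l v| <= M * hnorm v) -> exists u, forall v, ip u v = l v.
Proof.
move=> lP lM.
have [//|v _|u [p [_ _ hp]]] := @approx_limit setT l (M ^+ 2) _ lP.
  rewrite ipxx -exprMn -real_normK ?num_real // ler_sqr ?nnegrE //.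
  exact: le_trans (lM v).
by exists p => v; exact: hp.
Qed.

Lemma bounded_operator_ge0 (T : H -> H) : bounded_operator T ->
  exists2 M : R, 0 <= M & forall x, hnorm (T x) <= M * hnorm x.
Proof.
case=> _ [M hM]; exists `|M| => // x; apply: le_trans (hM x) _.
by rewrite ler_wpM2r ?hnorm_ge0 // ler_norm.
Qed.

(** Every bounded operator has an adjoint. *)
Lemma adjointP (T : H -> H) : bounded_operator T ->
  bounded_operator (adjoint T) /\
  forall x y, inner (T x) y = inner x (adjoint T y).
Proof.
move=> Tb; have [Tlin _] := Tb; rewrite /adjoint; apply: (@xgetPex _ (fun=> 0)
  [set T' | bounded_operator T' /\ forall x y, inner (T x) y = inner x (T' y)]).
have [M M0 TM] := bounded_operator_ge0 Tb.
have /choice[T' T'P] y : exists u, forall v, ip u v = ip y (T v).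
  apply: (@riesz _ (hnorm y * M)).
    by move=> u v c; rewrite linD // linZ // ipDr ipZr.
  move=> v; apply: le_trans (ip_le _ _) _.
  by rewrite -mulrA ler_wpM2l ?hnorm_ge0.
exists T'; split; last first.
  move=> x y; apply: inner_ip_ext => a.
  by rewrite -linZ // ipC -T'P ipC.
split.
  move=> a y z; apply: ip_inj => v.
  by rewrite T'P !ipDl !ip_scaleA !T'P linZ.
exists M => y; apply: le_mul_self; rewrite ?mulr_ge0 ?hnorm_ge0 //.
rewrite -ipxx T'P; apply: le_trans (ler_norm _) _.
apply: le_trans (ip_le _ _) _; have := TM (T' y).
have := hnorm_ge0 y; nra.
Qed.

End Completeness.

(** * Square roots of positive operators *)

Section PositiveOperators.
Context {R : realType} {k : scalar_kind} {H : hilbertType R k}.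
Implicit Types (x y : H) (T Q : H -> H).
Local Notation toK := (@of_real R k).

Lemma positive_operatorI T (M : R) : linear T ->
  (forall x, hnorm (T x) <= M * hnorm x) ->
  (forall x y, ip (T x) y = ip x (T y)) -> (forall x, 0 <= ip (T x) x) ->
  positive_operator T.
Proof.
move=> Tlin TM Tsym T0.
have Tadj x y : inner (T x) y = inner x (T y).
  by apply: inner_ip_ext => a; rewrite -linZ // Tsym.
split=> //; first by split=> //; exists M.
by move=> x; apply: conj_fix_ge0; rewrite ?T0 // -inner_sym Tadj.
Qed.

Lemma positive_ip_sym T : positive_operator T ->
  forall x y, ip (T x) y = ip x (T y).
Proof. by case=> _ Tsym _ x y; rewrite /ip Tsym. Qed.

Lemma positive_ip_ge0 T : positive_operator T -> forall x, 0 <= ip (T x) x.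
Proof.
case=> _ _ T0 x; rewrite -(of_real_le (k := k)) of_real0 of_real_re //.
Qed.

Lemma psd_operator T : linear T ->
  (forall x y, ip (T x) y = ip x (T y)) -> (forall x, 0 <= ip (T x) x) ->
  psd_form (fun x y => ip (T x) y).
Proof.
move=> Tlin Tsym T0; split=> // [x y|x y z|c x y].
- by rewrite Tsym ipC.
- by rewrite linD // ipDl.
- by rewrite linZ // ipZl.
Qed.

(** The norm of a positive operator is controlled by its quadratic form. *)
Lemma psd_operator_norm_le T (B : R) : psd_form (fun x y => ip (T x) y) ->
  0 <= B -> (forall x, ip (T x) x <= B * hnorm x ^+ 2) ->
  forall x, hnorm (T x) <= B * hnorm x.
Proof.
move=> TP B0 TB x; have [_ _ _ T0] := TP.
rewrite -ler_sqr ?nnegrE ?mulr_ge0 ?hnorm_ge0 //.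
apply: le_mul_self; rewrite ?sqr_ge0 // -[in leLHS]ipxx.
apply: le_trans (cauchy_schwarz x (T x) TP) _.
have -> : (B * hnorm x) ^+ 2 * hnorm (T x) ^+ 2 =
    (B * hnorm x ^+ 2) * (B * hnorm (T x) ^+ 2) by ring.
by apply: ler_pM (T0 _) (T0 _) (TB _) (TB _).
Qed.

End PositiveOperators.

Section SquareRoot.
Context {R : realType} {k : scalar_kind} {H : hilbertType R k}.
Implicit Types (x y : H).
Local Notation toK := (@of_real R k).

Variables (A : H -> H) (A_lin : linear A).
Hypotheses (A_sym : forall x y, ip (A x) y = ip x (A y))
  (A_le1 : forall x, hnorm (A x) <= hnorm x).

(** The iterates, starting at 0, of [Z |-> (A + Z^2) / 2]. *)
Fixpoint sqrt_iter n x : H :=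
  if n is n'.+1 then
    toK 2^-1 *: (A x + sqrt_iter n' (sqrt_iter n' x))
  else 0.

(** The scalar analogue of [sqrt_iter], in which [A] is replaced by 1; it
    dominates the norms of the iterates and of their increments. *)
Fixpoint sqrt_majorant n : R :=
  if n is n'.+1 then 2^-1 * (1 + sqrt_majorant n' ^+ 2) else 0.

Local Notation Y := sqrt_iter.
Local Notation y_ := sqrt_majorant.

Lemma sqrt_iter_lin n : linear (Y n).
Proof.
elim: n => [a x z|n IH a x z] /=; first by rewrite scaler0 addr0.
rewrite A_lin !IH [X in _ = X + _]scalerA [a * _]mulrC -scalerA -scalerDr.
by rewrite [a *: (_ + _)]scalerDr addrACA.
Qed.

Lemma sqrt_iter_sym n x z : ip (Y n x) z = ip x (Y n z).
Proof.
elim: n x z => [x z|n IH x z] /=; first by rewrite (ipC x) !ip0l.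
by rewrite ipZl ipZr ipDl ipDr A_sym !IH.
Qed.

Lemma sqrt_majorant_bound n : 0 <= y_ n <= 1.
Proof.
elim: n => [|n /andP[h0 h1]] /=; first by rewrite lexx ler01.
have := sqr_ge0 (y_ n); have : y_ n ^+ 2 <= 1 by rewrite expr_le1.
by move=> *; apply/andP; split; lra.
Qed.

Lemma sqrt_majorant_incr n : y_ n <= y_ n.+1.
Proof. by rewrite /=; have := sqr_ge0 (1 - y_ n); rewrite !expr2; lra. Qed.

Lemma sqrt_iter_le n x : hnorm (Y n x) <= y_ n * hnorm x.
Proof.
elim: n x => [x|n IH x] /=; first by rewrite mul0r hnorm0.
have /andP[h0 _] := sqrt_majorant_bound n.
rewrite hnormZ ger0_norm; last lra.
rewrite -mulrA ler_pM2l; last lra.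
rewrite mulrDl mul1r; apply: le_trans (hnormD _ _) _; apply: lerD => //.
apply: le_trans (IH _) _; rewrite expr2 -mulrA.
by apply: ler_wpM2l.
Qed.

Lemma sqrt_iter_step n x :
  hnorm (Y n.+1 x - Y n x) <= (y_ n.+1 - y_ n) * hnorm x.
Proof.
elim: n x => [x|n IH x].
  by have := sqrt_iter_le 1 x; rewrite /= !subr0.
set Y1 := Y n.+1; set y1 := y_ n.+1.
have -> : Y n.+2 x - Y1 x =
    toK 2^-1 *: (Y1 (Y1 x - Y n x) + (Y1 (Y n x) - Y n (Y n x))).
  rewrite (linB (sqrt_iter_lin n.+1 : linear Y1)) addrA subrK -scalerBr.
  by congr (_ *: _); rewrite opprD addrACA subrr add0r.
have -> : y_ n.+2 - y1 = 2^-1 * (y1 * (y1 - y_ n) + (y1 - y_ n) * y_ n).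
  have y1E : y1 = 2^-1 * (1 + y_ n ^+ 2) by [].
  have y2E : y_ n.+2 = 2^-1 * (1 + y1 ^+ 2) by [].
  rewrite y2E; lra.
have /andP[h0 _] := sqrt_majorant_bound n.
have /andP[h1 _] := sqrt_majorant_bound n.+1.
rewrite hnormZ ger0_norm; last lra.
rewrite -mulrA ler_pM2l; last lra.
rewrite mulrDl; apply: le_trans (hnormD _ _) _; apply: lerD.
  apply: le_trans (sqrt_iter_le _ _) _; rewrite -mulrA.
  by apply: ler_wpM2l => //; exact: IH.
apply: le_trans (IH _) _; rewrite -mulrA ler_wpM2l ?sqrt_iter_le //.
by rewrite subr_ge0; exact: sqrt_majorant_incr.
Qed.

Lemma sqrt_iter_dist n m x : (n <= m)%N ->
  hnorm (Y m x - Y n x) <= (y_ m - y_ n) * hnorm x.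
Proof.
elim: m => [|m IH].
  by rewrite leqn0 => /eqP ->; rewrite !subrr mul0r hnorm0.
rewrite leq_eqVlt => /predU1P[->|/IH h]; first by rewrite !subrr mul0r hnorm0.
have := hnormD (Y m.+1 x - Y m x) (Y m x - Y n x).
by rewrite addrA subrK; have := sqrt_iter_step m x; lra.
Qed.

(** The bounded increasing sequence of majorants converges to some [L]. *)
Lemma sqrt_majorant_gap : exists L : R,
  [/\ L <= 1, forall n, y_ n <= L & forall d, 0 < d -> exists n, L - y_ n < d].
Proof.
pose E := range y_.
have supE : has_sup E.
  split; first by exists (y_ 0), 0%N.
  by exists 1 => _ [n _ <-]; have /andP[] := sqrt_majorant_bound n.
exists (sup E); split.
- by apply: ge_sup => [|_ [n _ <-]];
    [exact: supE.1|have /andP[] := sqrt_majorant_bound n].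
- by move=> n; apply: ub_le_sup; [exact: supE.2|exists n].
- move=> d d0; have [_ [n _ <-] h] := sup_adherent d0 supE.
  by exists n; lra.
Qed.

(** The fixed point [Z = (A + Z^2) / 2], i.e. [(1 - Z)^2 = 1 - A]. *)
Lemma sqrt_iter_limit : exists Z : H -> H,
  [/\ linear Z, forall x z, ip (Z x) z = ip x (Z z),
      forall x, hnorm (Z x) <= hnorm x &
      forall x, Z x = toK 2^-1 *: (A x + Z (Z x))].
Proof.
have [L [L1 yL L0]] := sqrt_majorant_gap.
have /choice[Z ZP] x : exists z : H, Y n x @[n --> \oo] --> z /\
    forall n, hnorm (z - Y n x) <= (L - y_ n) * hnorm x.
  have [d d0|n m nm|z] := @cauchy_seq_limit _ _ H (Y^~ x)
      (fun n => (L - y_ n) * hnorm x); last by move=> *; exists z.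
    have h0 : 0 < hnorm x + 1 by have := hnorm_ge0 x; lra.
    have [n hn] := L0 _ (divr_gt0 d0 h0); exists n.
    move: hn; rewrite ltr_pdivlMr // => hn.
    by have := yL n; have := hnorm_ge0 x; nra.
  apply: le_trans (sqrt_iter_dist _ nm) _.
  by apply: ler_wpM2r; rewrite ?hnorm_ge0 // lerD2r.
have Zc x := (ZP x).1; have Zd x := (ZP x).2.
have Zle x : hnorm (Z x) <= hnorm x.
  have := Zd x 0%N; rewrite /= !subr0 => /le_trans; apply.
  by rewrite -[leRHS]mul1r ler_wpM2r ?hnorm_ge0.
exists Z; split=> //.
- move=> a x z; apply: hcvg_unique (Zc _) _.
  rewrite (_ : (fun n => _) = (fun n => a *: Y n x + Y n z)).
    by apply: cvgD => //; apply: cvgZl_tmp.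
  by apply/funext => n; rewrite sqrt_iter_lin.
- move=> x z; apply/eqP; rewrite -subr_eq0 -normr_le0.
  apply: (le0_vanishing (c := 2 * (hnorm x * hnorm z)) _ L0) => [|n].
    by rewrite !mulr_ge0 ?hnorm_ge0.
  have -> : ip (Z x) z - ip x (Z z) = ip (Z x - Y n x) z - ip x (Z z - Y n z).
    by rewrite ipBl ipBr sqrt_iter_sym; ring.
  apply: le_trans (ler_normB _ _) _.
  have := ip_le (Z x - Y n x) z; have := ip_le x (Z z - Y n z).
  have := ler_wpM2r (hnorm_ge0 z) (Zd x n).
  have := ler_wpM2l (hnorm_ge0 x) (Zd z n).
  lra.
- move=> x; apply/eqP; rewrite -subr_eq0; apply/eqP/hnorm_eq0/eqP.
  rewrite eq_le hnorm_ge0 andbT.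
  apply: (le0_vanishing (c := 2 * hnorm x) _ L0) => [|n].
    by rewrite !mulr_ge0 ?hnorm_ge0.
  have -> : Z x - toK 2^-1 *: (A x + Z (Z x)) = (Z x - Y n.+1 x)
      + toK 2^-1 *: (Y n (Y n x - Z x) - (Z (Z x) - Y n (Z x))).
    rewrite (linB (sqrt_iter_lin n)) /= opprB addrA subrK.
    rewrite -addrA; congr (_ + _); rewrite -!scalerN -scalerDr.
    by congr (_ *: _); rewrite !opprD addrA addrNK.
  apply: le_trans (hnormD _ _) _; rewrite hnormZ ger0_norm; last lra.
  have := hnormD (Y n (Y n x - Z x)) (- (Z (Z x) - Y n (Z x))).
  have := Zd (Z x) n; rewrite hnormN.
  have := sqrt_iter_le n (Y n x - Z x); rewrite (hnormBC _ (Z x)).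
  have := Zd x n; have := Zd x n.+1.
  have := sqrt_majorant_incr n; have := Zle x; have := hnorm_ge0 x.
  have := yL n; have /andP[] := sqrt_majorant_bound n.
  have := hnorm_ge0 (Z x - Y n x).
  set s := y_ n; set s1 := y_ n.+1; set h := hnorm x.
  move: (hnorm (Z x - Y n x)) (hnorm (Z x - Y n.+1 x)) => d d1.
  move=> d0 s0 s_le1 sL h0 hZ ss1 hd1 hd h1 h2 h3.
  have : s * d <= d by rewrite ler_piMl.
  have : (L - s1) * h <= (L - s) * h by rewrite ler_wpM2r ?lerD2l ?lerN2.
  have : (L - s) * hnorm (Z x) <= (L - s) * h by rewrite ler_wpM2l ?subr_ge0.
  lra.
Qed.

End SquareRoot.

Section SquareRootExistence.
Context {R : realType} {k : scalar_kind} {H : hilbertType R k}.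
Implicit Types (x y : H) (T Q : H -> H).
Local Notation toK := (@of_real R k).

Lemma linear_scale T (c : R) : linear T -> linear (fun x => toK c *: T x).
Proof.
by move=> Tlin a x z; rewrite Tlin scalerDr !scalerA mulrC.
Qed.

(** The square root is [Q = 1 - Z], where [Z] is the fixed point for
    [A = 1 - T]. *)
Lemma sqrt_contraction T : linear T ->
  (forall x y, ip (T x) y = ip x (T y)) -> (forall x, 0 <= ip (T x) x) ->
  (forall x, ip (T x) x <= hnorm x ^+ 2) ->
  exists Q, positive_operator Q /\ Q \o Q = T.
Proof.
move=> Tlin Tsym T0 T1; pose A x := x - T x.
have Alin : linear A.
  by move=> a x z; rewrite /A Tlin scalerBr addrACA opprD.
have Asym x z : ip (A x) z = ip x (A z) by rewrite ipBl ipBr Tsym.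
have A0 x : 0 <= ip (A x) x by rewrite ipBl subr_ge0 ipxx.
have Ale1 x : hnorm (A x) <= hnorm x.
  rewrite -[leRHS]mul1r; apply: psd_operator_norm_le => // [|z].
    exact: psd_operator.
  by rewrite mul1r ipBl ipxx lerBlDr lerDl.
have [Z [Zlin Zsym Zle Zfix]] := sqrt_iter_limit Alin Asym Ale1.
exists (fun x => x - Z x); split.
  apply: (@positive_operatorI _ _ _ _ 2).
  - by move=> a x z; rewrite Zlin scalerBr addrACA opprD.
  - move=> x; have := hnormD x (- Z x); rewrite hnormN; have := Zle x; lra.
  - by move=> x z; rewrite ipBl ipBr Zsym.
  - move=> x; rewrite ipBl ipxx subr_ge0.
    apply: le_trans (ler_norm _) _; apply: le_trans (ip_le _ _) _.
    by rewrite expr2 ler_wpM2r ?hnorm_ge0.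
apply/funext => x /=.
have ZE : Z x + Z x = A x + Z (Z x).
  rewrite [in LHS](Zfix x) -scalerDl -of_realD.
  by rewrite (_ : 2^-1 + 2^-1 = 1) ?of_real1 ?scale1r //; field.
rewrite (linB Zlin) opprB addrACA.
by rewrite -opprD ZE opprD addrACA subrr addr0 subKr.
Qed.

(** Every positive operator has a positive square root. *)
Lemma sqrt_operatorP T : positive_operator T ->
  positive_operator (sqrt_operator T) /\
  sqrt_operator T \o sqrt_operator T = T.
Proof.
move=> TP; rewrite /sqrt_operator; apply: (@xgetPex _ (fun=> 0)
  [set Q | positive_operator Q /\ Q \o Q = T]).
have [[Tlin _] _ _] := TP; have [Tb _ _] := TP.
have [M M0 TM] := bounded_operator_ge0 Tb.
have Tsym := positive_ip_sym TP; have T0 := positive_ip_ge0 TP.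
(* Rescaling by [N] makes the operator a contraction; [M] may vanish. *)
pose N := M + 1; have N0 : 0 < N by rewrite /N; lra.
pose T1 x := toK N^-1 *: T x.
have [| | | |Q [QP QQ]] := @sqrt_contraction T1.
- exact: linear_scale.
- by move=> x z; rewrite ipZl ipZr Tsym.
- by move=> x; rewrite ipZl mulr_ge0 // invr_ge0 ltW.
- move=> x; rewrite ipZl mulrC ler_pdivrMr //.
  apply: le_trans (ler_norm _) _; apply: le_trans (ip_le _ _) _.
  by have := TM x; have := hnorm_ge0 x; rewrite /N; nra.
have [Qb _ _] := QP; have [Qlin _] := Qb.
have [C C0 QC] := bounded_operator_ge0 Qb.
pose s := Num.sqrt N; exists (fun x => toK s *: Q x); split.
  apply: (@positive_operatorI _ _ _ _ (s * C)).
  - exact: linear_scale.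
  - move=> x; rewrite hnormZ ger0_norm ?sqrtr_ge0 // -mulrA.
    by rewrite ler_wpM2l ?sqrtr_ge0.
  - by move=> x z; rewrite ipZl ipZr (positive_ip_sym QP).
  - by move=> x; rewrite ipZl mulr_ge0 ?sqrtr_ge0 ?positive_ip_ge0.
apply/funext => x /=.
have QQx : Q (Q x) = T1 x by rewrite -QQ.
rewrite linZ // scalerA -of_realM -expr2 sqr_sqrtr ?ltW // QQx /T1.
by rewrite scalerA -of_realM divff ?of_real1 ?scale1r // gt_eqF.
Qed.

End SquareRootExistence.

(** * Unconditional sums *)

Section FiniteSums.
Context {R : realType} {I : choiceType}.
Implicit Types (A B : {fset I}) (c : I -> R).

Lemma partial_sumE (V : zmodType) (u : I -> V) A :
  summability.partial_sum u A = \sum_(i <- A) u i.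
Proof. by rewrite big_seq_fsetE. Qed.

Lemma sum_fsetD (V : zmodType) (u : I -> V) A B : (A `<=` B)%fset ->
  \sum_(i <- B) u i = \sum_(i <- A) u i + \sum_(i <- (B `\` A)%fset) u i.
Proof.
move=> AB; rewrite (big_fsetID _ (mem A)) /=; congr (_ + _).
  apply: eq_fbigl => i; rewrite !inE /= andbC.
  by case: (boolP (i \in A)) => // /(fsubsetP AB).
by apply: eq_fbigl => i; rewrite !inE /= andbC.
Qed.

Lemma ler_sum_fset c A B : (forall i, 0 <= c i) -> (A `<=` B)%fset ->
  \sum_(i <- A) c i <= \sum_(i <- B) c i.
Proof. by move=> c0 /sum_fsetD ->; rewrite lerDl sumr_ge0. Qed.

Lemma esum_le_fsetP c (C : R) :
  (\esum_(i in [set: I]) (c i)%:E <= C%:E)%E <->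
  forall A, \sum_(i <- A) c i <= C.
Proof.
split=> [h A|h].
  rewrite -lee_fin; apply: le_trans h; apply: esum_ge; exists [set` A] => //.
  by rewrite fsbig_finite //= set_fsetK sumEFin.
apply: ge_ereal_sup => _ [D [Dfin _] <-].
by rewrite fsbig_finite //= sumEFin lee_fin.
Qed.

End FiniteSums.

#[local] Existing Instance summability.totally_filter.

Section HasSum.
Context {R : realType} {k : scalar_kind} {H : hilbertType R k} {I : countType}.
Implicit Types (A : {fset I}) (u v a b : I -> H).
Local Notation toK := (@of_real R k).

Lemma near_totallyP (P : {fset I} -> Prop) :
  (\forall A \near summability.totally, P A) <->
  exists A0, forall A, (A0 `<=` A)%fset -> P A.
Proof.
split; first by case=> A0 _ h; exists A0 => A; exact: h.
by case=> A0 h; exists A0.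
Qed.

(** Unconditional summability, in terms of finite sets. *)
Lemma has_sumP u (s : H) : has_sum u s <-> forall e : R, 0 < e ->
  exists A0, forall A, (A0 `<=` A)%fset -> hnorm (s - \sum_(i <- A) u i) < e.
Proof.
split=> h.
  move=> e e0; apply/near_totallyP.
  have /hcvgP/(_ e e0) := h; apply: filterS => A.
  by rewrite partial_sumE.
apply/hcvgP => e e0; have /near_totallyP := h e e0; apply: filterS => A.
by rewrite partial_sumE.
Qed.

Lemma has_sum_linear (c : scalar R k) u v (s t : H) :
  has_sum u s -> has_sum v t ->
  has_sum (fun i => c *: u i + v i) (c *: s + t).
Proof.
move=> us vt; rewrite /has_sum (_ : summability.partial_sum _ = fun A =>
  c *: summability.partial_sum u A + summability.partial_sum v A).
  by apply: cvgD => //; apply: cvgZl_tmp.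
apply/funext => A.
by rewrite !partial_sumE big_split /= scaler_sumr.
Qed.

Lemma has_sum_unique u (s t : H) : has_sum u s -> has_sum u t -> s = t.
Proof. exact: hcvg_unique. Qed.

Lemma has_sum_ip u (s y : H) (e : R) : has_sum u s -> 0 < e ->
  exists A0, forall A, (A0 `<=` A)%fset ->
    `|ip s y - \sum_(i <- A) ip (u i) y| < e.
Proof.
move=> /has_sumP us e0; have y0 := hnorm_ge0 y.
have y1 : 0 < hnorm y + 1 by lra.
have [A0 hA] := us _ (divr_gt0 e0 y1); exists A0 => A /hA.
rewrite -ip_suml -ipBl ltr_pdivlMr //; apply: le_lt_trans.
apply: le_trans (ip_le _ _) _.
by rewrite ler_wpM2l ?hnorm_ge0 // lerDl.
Qed.

Lemma sum_ip_le a b A : (\sum_(i <- A) ip (a i) (b i)) ^+ 2 <=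
  (\sum_(i <- A) hnorm (a i) ^+ 2) * (\sum_(i <- A) hnorm (b i) ^+ 2).
Proof.
apply: discriminant_le => [|t].
  by apply: sumr_ge0 => i _; exact: sqr_ge0.
rewrite !mulr_sumr -!big_split /=; apply: sumr_ge0 => i _.
by rewrite -!ipxx -psd_form_expand; [rewrite ipxx sqr_ge0|exact: psd_ip].
Qed.

Lemma hnorm_cvg (y : nat -> H) (z : H) :
  y @ \oo --> z -> hnorm (y n) @[n --> \oo] --> hnorm z.
Proof.
move=> /hcvgP yz; apply/cvgrPdist_lt => e /yz; apply: filterS => n.
apply: le_lt_trans; rewrite ler_norml.
have := hnormD (z - y n) (y n); have := hnormD (y n - z) z.
rewrite !subrK (hnormBC (y n)) => h1 h2.
by apply/andP; split; lra.
Qed.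

(** A bound on finitely many coordinates passes to coordinatewise limits. *)
Lemma sum_hnorm_limit_le (v : nat -> I -> H) a b A (C : R) n0 :
  (forall i, v n i @[n --> \oo] --> a i) ->
  (forall n, (n0 <= n)%N -> \sum_(i <- A) hnorm (v n i - b i) ^+ 2 <= C) ->
  \sum_(i <- A) hnorm (a i - b i) ^+ 2 <= C.
Proof.
move=> va vC.
have vs : \sum_(i <- A) hnorm (v n i - b i) ^+ 2 @[n --> \oo] -->
    \sum_(i <- A) hnorm (a i - b i) ^+ 2.
  apply: cvg_big => [|i _]; first exact: add_continuous.
  by apply: cvgM; apply: hnorm_cvg; apply: cvgB => //; exact: cvg_cst.
by apply: (closed_cvg [set x | x <= C] (@closed_le R C) _ _ vs); exists n0.
Qed.

Lemma l2_norm_leP (a : I -> H) (C : R) : 0 <= C ->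
  (\esum_(i in [set: I]) (hnorm (a i) ^+ 2)%:E < +oo)%E ->
  l2_norm a <= C <-> forall A, \sum_(i <- A) hnorm (a i) ^+ 2 <= C ^+ 2.
Proof.
move=> C0 afin; rewrite -(esum_le_fsetP (fun i => hnorm (a i) ^+ 2)) /l2_norm.
set E := esum _ _ in afin *.
have E0 : (0 <= E)%E by apply: esum_ge0 => i _; rewrite lee_fin sqr_ge0.
have Efin : E \is a fin_num by rewrite ge0_fin_numE.
rewrite -[in X in _ <-> X](fineK Efin) lee_fin.
have fE0 : 0 <= fine E by exact: fine_ge0.
rewrite -[X in _ <= X <-> _](ger0_norm C0) -sqrtr_sqr.
by rewrite ler_sqrt // sqr_ge0.
Qed.

End HasSum.

(** * The frame operator of a Bessel fusion sequence *)

Section FrameOperator.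
Context {R : realType} {k : scalar_kind} {H : hilbertType R k} {I : countType}.
Local Notation toK := (@of_real R k).
Variables (W : I -> set H) (w : I -> R).
Hypothesis W_bessel : bessel_fusion_sequence W w.
Implicit Types (A : {fset I}) (f g x y : H) (a : I -> H).

Lemma proj_in i f : W i (proj (W i) f).
Proof. by have [Wc _ _] := W_bessel; have [] := projP f (Wc i). Qed.

Lemma subspace_linear i (c : scalar R k) x y :
  W i x -> W i y -> W i (c *: x + y).
Proof. by have [/(_ i)[_ _ WP] _ _] := W_bessel; exact: WP. Qed.

Lemma subspace0 i : W i 0.
Proof. by have [/(_ i)[_ ? _] _ _] := W_bessel. Qed.

Lemma ip_proj i x f : W i x -> ip x (proj (W i) f) = ip x f.
Proof.
move=> Wx; have [Wc _ _] := W_bessel; have [_ /(_ _ Wx) h] := projP f (Wc i).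
apply/eqP; rewrite eq_sym -subr_eq0 -ipBr ipC /ip h -of_real0 reK //.
Qed.

(** The coordinates of the analysis operator, the adjoint of synthesis. *)
Definition analysis i f : H := toK (w i) *: proj (W i) f.

Lemma analysis_in i f : W i (analysis i f).
Proof.
rewrite -[analysis i f]addr0; apply: subspace_linear (subspace0 i).
exact: proj_in.
Qed.

Lemma ip_analysis i x f : W i x -> ip x (analysis i f) = w i * ip x f.
Proof. by move=> Wx; rewrite ipZr ip_proj. Qed.

Lemma analysis_linear i : linear (analysis i).
Proof.
move=> c x y; apply/eqP; rewrite -subr_eq0.
(* [d] lies in [W i] and is orthogonal to it. *)
set d := _ - _; have Wd : W i d.
  have -> : d =
      -1 *: (c *: analysis i x + analysis i y) + analysis i (c *: x + y).
    by rewrite scaleN1r addrC.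
  apply: subspace_linear; last exact: analysis_in.
  by apply: subspace_linear; exact: analysis_in.
apply/eqP/hnorm_eq0/eqP; rewrite -sqrf_eq0 -ipxx {2}/d; apply/eqP.
rewrite ipBr ipDr !ip_analysis // [ip d (c *: analysis i x)]ipC ip_scaleA.
have Wcd : W i (conj c *: d).
  by rewrite -[_ *: _]addr0; apply: subspace_linear (subspace0 i).
rewrite [ip (analysis i x) _]ipC ip_analysis // ip_scaleA conjK ipDr; ring.
Qed.

Lemma frame_termE i f :
  toK (w i ^+ 2) *: proj (W i) f = toK (w i) *: analysis i f.
Proof. by rewrite /analysis scalerA -of_realM. Qed.

Lemma bessel_bound : exists2 B : R, 0 <= B & forall f A,
  \sum_(i <- A) hnorm (analysis i f) ^+ 2 <= B * hnorm f ^+ 2.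
Proof.
have [_ w0 [B hB]] := W_bessel; exists `|B| => // f A.
have /esum_le_fsetP/(_ A) h := hB f.
apply: le_trans (ler_wpM2r (sqr_ge0 _) (ler_norm B)); apply: le_trans h.
rewrite le_eqVlt; apply/orP; left; apply/eqP; apply: eq_bigr => i _.
by rewrite hnormZ exprMn gtr0_norm.
Qed.

Section Synthesis.
Variables (B : R) (B0 : 0 <= B).
Hypothesis BP : forall f A,
  \sum_(i <- A) hnorm (analysis i f) ^+ 2 <= B * hnorm f ^+ 2.

(** The synthesis operator [a |-> sum_i w_i a_i] is bounded because its
    adjoint, the analysis operator, is. *)
Lemma synthesis_le a A : (forall i, W i (a i)) ->
  hnorm (\sum_(i <- A) toK (w i) *: a i) ^+ 2 <=
  B * \sum_(i <- A) hnorm (a i) ^+ 2.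
Proof.
move=> Wa; set g := \sum_(i <- A) _.
have s0 : 0 <= \sum_(i <- A) hnorm (a i) ^+ 2.
  by apply: sumr_ge0 => i _; exact: sqr_ge0.
apply: le_mul_self; rewrite ?sqr_ge0 ?mulr_ge0 // -[in leLHS]ipxx {1}/g.
rewrite ip_suml (eq_bigr (fun i => ip (a i) (analysis i g))); last first.
  by move=> i _; rewrite ipZl ip_analysis.
apply: le_trans (sum_ip_le _ _ _) _.
by have := ler_wpM2l s0 (BP g A); lra.
Qed.

(** Synthesis of a square-summable family converges: the tails of the sum are
    controlled by the tails of the square norms. *)
Lemma synthesis_summable a (C : R) : (forall i, W i (a i)) ->
  (forall A, \sum_(i <- A) hnorm (a i) ^+ 2 <= C) ->
  exists s : H, has_sum (fun i => toK (w i) *: a i) s.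
Proof.
move=> Wa aC; apply: hcauchy_cvg => e e0.
pose E := range (fun A => \sum_(i <- A) hnorm (a i) ^+ 2).
have supE : has_sup E.
  split; first by exists (\sum_(i <- fset0) hnorm (a i) ^+ 2), fset0.
  by exists C => _ [A _ <-].
have B1 : 0 < B + 1 by rewrite ltr_wpDl.
have [_ [A0 _ <-] hA0] := sup_adherent (divr_gt0 (exprn_gt0 2 e0) B1) supE.
exists (\sum_(i <- A0) toK (w i) *: a i).
apply/near_totallyP; exists A0 => A sA.
rewrite partial_sumE (sum_fsetD _ sA) opprD addrA subrr sub0r hnormN.
rewrite -ltr_sqr ?nnegrE ?hnorm_ge0 ?(ltW e0) //.
apply: le_lt_trans (synthesis_le _ Wa) _.
have : \sum_(i <- A) hnorm (a i) ^+ 2 <= sup E.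
  by apply: ub_le_sup; [exact: supE.2|exists A].
rewrite (sum_fsetD _ sA); set s := \sum_(i <- (A `\` A0)%fset) _ => hs.
have s0 : 0 <= s by apply: sumr_ge0 => i _; exact: sqr_ge0.
have : s < e ^+ 2 / (B + 1) by lra.
rewrite ltr_pdivlMr //; lra.
Qed.

Local Notation S := (frame_operator W w).

Lemma frame_has_sum f : has_sum (fun i => toK (w i) *: analysis i f) (S f).
Proof.
have [s hs] := synthesis_summable (fun i => analysis_in i f) (BP f).
rewrite /frame_operator (_ : (fun i => _) = fun i => toK (w i) *: analysis i f).
  by rewrite /summability.sum (cvg_lim _ hs) //; exact: norm_hausdorff.
by apply/funext => i; exact: frame_termE.
Qed.

(** [<S f, g> = sum_i <T_i f, T_i g>], where [T_i] is [analysis i]. *)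
Lemma frame_ip f g (e : R) : 0 < e ->
  exists A0, forall A, (A0 `<=` A)%fset ->
    `|ip (S f) g - \sum_(i <- A) ip (analysis i f) (analysis i g)| < e.
Proof.
move=> e0; have [A0 h] := has_sum_ip g (frame_has_sum (f := f)) e0.
exists A0 => A /h; rewrite (eq_bigr (fun i =>
  ip (analysis i f) (analysis i g))) // => i _.
by rewrite ipZl ip_analysis //; exact: analysis_in.
Qed.

Lemma frame_linear : linear S.
Proof.
move=> c f g; apply: has_sum_unique (frame_has_sum (f := _)) _.
rewrite (_ : (fun i => _) = fun i =>
    c *: (toK (w i) *: analysis i f) + toK (w i) *: analysis i g).
  by apply: has_sum_linear; exact: frame_has_sum.
apply/funext => i.
by rewrite analysis_linear scalerDr !scalerA [c * _]mulrC.
Qed.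

Lemma frame_sym f g : ip (S f) g = ip f (S g).
Proof.
apply/eqP; rewrite -subr_eq0 -normr_le0; apply/ler_addgt0Pr => e e0.
have e2 : 0 < e / 2 by lra.
have [A0 /(_ (A0 `|` _)%fset) h0] := frame_ip f g e2.
have [A1 h1] := frame_ip g f e2.
have := h0 A1 (fsubsetUl _ _); have := h1 _ (fsubsetUr A0 A1).
rewrite [ip (S g) f]ipC.
under eq_bigr do rewrite ipC.
rewrite add0r !ltr_norml !ler_norml => /andP[? ?] /andP[? ?].
by apply/andP; split; lra.
Qed.

Lemma frame_ge f A : \sum_(i <- A) hnorm (analysis i f) ^+ 2 <= ip (S f) f.
Proof.
apply/ler_addgt0Pr => e e0; have [A0 h] := frame_ip f f e0.
have := h _ (fsubsetUl A0 A).
have : \sum_(i <- A) hnorm (analysis i f) ^+ 2 <=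
    \sum_(i <- (A0 `|` A)%fset) hnorm (analysis i f) ^+ 2.
  by apply: ler_sum_fset (fsubsetUr _ _) => i; exact: sqr_ge0.
under [in X in _ -> X]eq_bigr do rewrite ipxx.
by rewrite ltr_norml => h1 /andP[h2 h3]; lra.
Qed.

Lemma frame_le f : ip (S f) f <= B * hnorm f ^+ 2.
Proof.
apply/ler_addgt0Pr => e e0; have [A0 h] := frame_ip f f e0.
have := h _ (fsubset_refl A0).
under eq_bigr do rewrite ipxx.
by rewrite ltr_norml => /andP[_]; have := BP f A0; lra.
Qed.

Lemma frame_ge0 f : 0 <= ip (S f) f.
Proof. by have := frame_ge f fset0; rewrite big_seq_fset0. Qed.

Lemma frame_psd : psd_form (fun x y => ip (S x) y).
Proof.
apply: psd_operator; [exact: frame_linear|exact: frame_sym|exact: frame_ge0].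
Qed.

Lemma frame_positive : positive_operator S.
Proof.
apply: (@positive_operatorI _ _ _ _ B);
  [exact: frame_linear| |exact: frame_sym|exact: frame_ge0].
exact: psd_operator_norm_le frame_psd B0 frame_le.
Qed.

Lemma sqrt_frame_hnorm f : hnorm (sqrt_operator S f) ^+ 2 = ip (S f) f.
Proof.
have [QP QQ] := sqrt_operatorP frame_positive.
by rewrite -ipxx -(positive_ip_sym QP) -[in RHS]QQ.
Qed.

End Synthesis.
End FrameOperator.

(** * Quotients and atomic systems *)

Section Quotients.
Context {R : realType} {k : scalar_kind} {H : hilbertType R k}.

(** A bounded quotient is a domination of [U] by [V]; the kernel inclusion
    makes the choice of preimages in [quotient] irrelevant. *)
Lemma bounded_quotientP (U V : H -> H) : linear U -> linear V ->
  bounded_quotient U V <->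
  exists2 M : R, 0 <= M & forall x, hnorm (U x) <= M * hnorm (V x).
Proof.
move=> Ulin Vlin; split=> [[NVU [M hM]]|[M M0 hM]].
  exists `|M| => // x.
  have {hM} := hM (V x) (ex_intro2 _ _ x I erefl).
  rewrite /quotient; set x' := xget _ _.
  have Vx' : V x' = V x by apply: (@xgetI _ 0 [set z | V z = V x] x).
  have /eqP : U (x' - x) = 0 by apply: NVU; rewrite /= linB // Vx' subrr.
  rewrite linB // subr_eq0 => /eqP -> /le_trans; apply.
  by rewrite ler_wpM2r ?hnorm_ge0 // ler_norm.
split=> [x /= Vx|].
  apply/hnorm_eq0/eqP; rewrite eq_le hnorm_ge0 andbT.
  by have := hM x; rewrite Vx hnorm0 mulr0.
exists M => _ [x _ <-]; rewrite /quotient.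
by rewrite -[in leRHS](@xgetI _ 0 [set z | V z = V x] x).
Qed.

End Quotients.

Section AtomicSystems.
Context {R : realType} {k : scalar_kind} {H : hilbertType R k} {I : countType}.
Local Notation toK := (@of_real R k).
Variables (K : H -> H) (K_bounded : bounded_operator K).
Variables (W : I -> set H) (w : I -> R).
Hypothesis W_bessel : bessel_fusion_sequence W w.
Implicit Types (A : {fset I}) (f g x y : H) (a : I -> H).
Local Notation S := (frame_operator W w).
Local Notation Q := (sqrt_operator S).
Local Notation analysis := (analysis W w).

Lemma ip_adjoint x y : ip (K x) y = ip x (adjoint K y).
Proof. by rewrite /ip (adjointP K_bounded).2. Qed.

(** The necessity half: expand [K f] for [f = K^* g] and pair it with [g]. *)
Lemma atomic_system_dominated : atomic_system K W w ->
  exists2 M : R, 0 <= M & forall g, hnorm (adjoint K g) <= M * hnorm (Q g).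
Proof.
case=> _ [C C0 KC]; exists C; first exact: ltW.
move=> g; set f := adjoint K g.
have [B B0 BP] := bessel_bound W_bessel.
have [a [[Wa afin] aC Ka]] := KC f.
have Cf0 : 0 <= C * hnorm f by rewrite mulr_ge0 ?hnorm_ge0 ?ltW.
have aCf := (l2_norm_leP Cf0 afin).1 aC.
have Qg0 := hnorm_ge0 (Q g).
apply: le_mul_self; rewrite ?mulr_ge0 ?hnorm_ge0 ?(ltW C0) //.
rewrite -[in leLHS]ipxx -ip_adjoint; apply/ler_addgt0Pr => e e0.
have [A /(_ A (fsubset_refl A))] := has_sum_ip g Ka e0.
rewrite (eq_bigr (fun i => ip (a i) (analysis i g))); last first.
  by move=> i _; rewrite ipZl ip_analysis.
suff : \sum_(i <- A) ip (a i) (analysis i g) <= C * hnorm (Q g) * hnorm f.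
  by rewrite ltr_norml => ? /andP[_]; lra.
apply: le_trans (ler_norm _) _.
rewrite -ler_sqr ?nnegrE ?mulr_ge0 ?hnorm_ge0 ?(ltW C0) //.
rewrite real_normK ?num_real //.
apply: le_trans (sum_ip_le _ _ _) _.
rewrite mulrAC exprMn (sqrt_frame_hnorm W_bessel B0 BP).
apply: ler_pM _ _ (aCf A) (frame_ge W_bessel B0 BP g A);
  by apply: sumr_ge0 => i _; exact: sqr_ge0.
Qed.

(** The sufficiency half: the coefficients are the limits of the analysis
    coordinates of almost minimisers [u n]. *)
Lemma dominated_atomic_system (M : R) : 0 <= M ->
  (forall g, hnorm (adjoint K g) <= M * hnorm (Q g)) -> atomic_system K W w.
Proof.
(* [M] may be zero, while the constant of an atomic system is positive. *)
move=> M0 KM; split=> //; exists (M + 1); first by lra.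
move=> f; have [B B0 BP] := bessel_bound W_bessel.
have Spsd := frame_psd W_bessel B0 BP; have [_ _ _ S0] := Spsd.
have Slin := frame_linear W_bessel B0 BP.
pose q x y := ip (S x) y; pose c := M * hnorm f.
have c0 : 0 <= c by rewrite mulr_ge0 ?hnorm_ge0.
have qle g : Num.sqrt (q g g) <= Num.sqrt B * hnorm g.
  rewrite -[hnorm g]ger0_norm ?hnorm_ge0 // -sqrtr_sqr -sqrtrM //.
  by rewrite ler_wsqrtr // (frame_le W_bessel B0 BP).
have lM v : ip (K f) v ^+ 2 <= c ^+ 2 * q v v.
  rewrite ip_adjoint /q -(sqrt_frame_hnorm W_bessel B0 BP) -exprMn.
  rewrite -real_normK ?num_real // ler_sqr ?nnegrE ?mulr_ge0 ?hnorm_ge0 //.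
  apply: le_trans (ip_le _ _) _; rewrite /c mulrAC [M * _ * _]mulrC.
  by rewrite ler_wpM2l ?hnorm_ge0.
pose e n : R := n.+1%:R^-1.
have e0 n : 0 < e n by rewrite /e invr_gt0.
have e_lt d : 0 < d -> exists n, e n < d by exact: inv_succ_lt.
have e_le n m : (n <= m)%N -> e m <= e n.
  by move=> nm; rewrite lef_pV2 ?posrE // ler_nat.
have /choice[u uP] n : exists u, forall v,
    `|q u v - ip (K f) v| <= e n * Num.sqrt (q v v).
  have [|u _ hu] := approx_representation (D := setT) Spsd _
    (real_linear_ip (K f)) (fun v _ => lM v) (e0 n); first by [].
  by exists u => v; exact: hu.
(* The [u n] form a Cauchy sequence for the form of [S], not for the norm. *)
have u_cauchy n m : (n <= m)%N ->
    Num.sqrt (q (u m - u n) (u m - u n)) <= 2 * e n.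
  move=> nm; have h := approx_representation_close (D := setT) Spsd Logic.I
    (ltW (e0 m)) (ltW (e0 n)) (fun v _ => uP m v) (fun v _ => uP n v).
  by apply: le_trans h _; have := e_le _ _ nm; lra.
have u_le n : Num.sqrt (q (u n) (u n)) <= c + e n.
  apply: le_mul_self; [exact: sqrtr_ge0|by rewrite addr_ge0 // ltW|].
  rewrite sqr_sqrtr ?S0 // mulrDl.
  have := uP n (u n); rewrite ler_norml => /andP[_].
  have := sqr_le_norm_sqrt c0 (lM (u n)); rewrite ler_norml => /andP[_].
  lra.
have analysis_le i x : hnorm (analysis i x) <= Num.sqrt (q x x).
  rewrite -ler_sqr ?nnegrE ?hnorm_ge0 ?sqrtr_ge0 // sqr_sqrtr ?S0 //.
  by have := frame_ge W_bessel B0 BP x [fset i]%fset; rewrite big_seq_fset1.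
have sum_le A x d : Num.sqrt (q x x) <= d ->
    \sum_(i <- A) hnorm (analysis i x) ^+ 2 <= d ^+ 2.
  move=> xd; apply: le_trans (frame_ge W_bessel B0 BP x A) _.
  rewrite -[leLHS]sqr_sqrtr ?S0 // ler_sqr ?nnegrE ?sqrtr_ge0 //.
  exact: le_trans xd.
have /choice[a ua] i : exists z : H, analysis i (u n) @[n --> \oo] --> z.
  have [d d0|n m nm|z uz _] := @cauchy_seq_limit _ _ H
      (fun n => analysis i (u n)) (fun n => 2 * e n); last by exists z.
    have [|n hn] := e_lt (d / 2); first by lra.
    by exists n; rewrite mulrC -ltr_pdivlMr.
  rewrite -(linB (analysis_linear W_bessel i)).
  exact: le_trans (analysis_le _ _) (u_cauchy _ _ nm).
have Wa i : W i (a i).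
  have [Wc _ _] := W_bessel; have [Wi _ _] := Wc i.
  apply: (closed_cvg (W i) Wi _ (a i) (ua i)); apply: nearW => n.
  exact: analysis_in.
have a_le A : \sum_(i <- A) hnorm (a i) ^+ 2 <= c ^+ 2.
  have s0 : 0 <= \sum_(i <- A) hnorm (a i) ^+ 2.
    by apply: sumr_ge0 => i _; exact: sqr_ge0.
  rewrite -[leLHS]sqr_sqrtr // ler_sqr ?nnegrE ?sqrtr_ge0 // -subr_le0.
  apply: (le0_vanishing (c := 1) ler01 e_lt) => n; rewrite mul1r lerBlDl.
  have ce0 : 0 <= c + e n by rewrite addr_ge0 // ltW.
  rewrite -[leRHS]ger0_norm // -sqrtr_sqr ler_wsqrtr //.
  rewrite (eq_bigr (fun i => hnorm (a i - 0) ^+ 2)); last first.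
    by move=> i _; rewrite subr0.
  apply: (sum_hnorm_limit_le (b := fun=> 0) (n0 := n) ua) => m nm.
  rewrite (eq_bigr (fun i => hnorm (analysis i (u m)) ^+ 2)); last first.
    by move=> i _; rewrite subr0.
  apply: sum_le; apply: le_trans (u_le m) _.
  by rewrite lerD2l e_le.
have a_dist n A :
    \sum_(i <- A) hnorm (a i - analysis i (u n)) ^+ 2 <= (2 * e n) ^+ 2.
  apply: (sum_hnorm_limit_le (n0 := n) ua) => m nm.
  rewrite (eq_bigr (fun i => hnorm (analysis i (u m - u n)) ^+ 2)).
    exact: sum_le (u_cauchy _ _ nm).
  by move=> i _; rewrite (linB (analysis_linear W_bessel i)).
have afin : (\esum_(i in [set: I]) (hnorm (a i) ^+ 2)%:E < +oo)%E.
  have /esum_le_fsetP/le_lt_trans := a_le; apply; exact: ltry.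
exists a; split=> //.
  apply: (@le_trans _ _ c); first by apply/(l2_norm_leP c0 afin).
  by rewrite /c; have := hnorm_ge0 f; lra.
(* [K f] is compared with [S (u n)], [S (u n)] with its partial sums, and
   these with the partial sums of the synthesis of [a]. *)
apply/has_sumP => d d0; set s := Num.sqrt B.
have s0 : 0 <= s by exact: sqrtr_ge0.
(* The approximate equation is tested on the difference itself. *)
have Su n : hnorm (S (u n) - K f) <= e n * s.
  apply: le_mul_self; rewrite ?hnorm_ge0 ?mulr_ge0 ?(ltW (e0 n)) //.
  rewrite -ipxx {1}ipBl -mulrA; apply: le_trans (ler_norm _) _.
  apply: le_trans (uP n _) _.
  by rewrite ler_wpM2l ?(ltW (e0 n)).
have [|n hn] := e_lt (d / (2 * (3 * s + 1))).
  by rewrite divr_gt0 // mulr_gt0 //; lra.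
have d2 : 0 < d / 2 by lra.
have /has_sumP/(_ _ d2)[A0 hA0] := frame_has_sum W_bessel B0 BP (f := u n).
exists A0 => A /hA0 hA.
have hT : hnorm (\sum_(i <- A) toK (w i) *: (a i - analysis i (u n))) <=
    s * (2 * e n).
  have e20 : 0 <= 2 * e n by rewrite mulr_ge0 ?(ltW (e0 n)).
  have se0 := mulr_ge0 s0 e20.
  rewrite -ler_sqr ?nnegrE ?hnorm_ge0 // exprMn sqr_sqrtr //.
  apply: le_trans (synthesis_le W_bessel B0 BP A _) _.
    move=> i; rewrite addrC -scaleN1r; apply: (subspace_linear W_bessel) => //.
    exact: (analysis_in W_bessel).
  by rewrite ler_wpM2l.
have -> : K f - \sum_(i <- A) toK (w i) *: a i =
    (K f - S (u n)) + (S (u n) - \sum_(i <- A) toK (w i) *: analysis i (u n))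
    + (- \sum_(i <- A) toK (w i) *: (a i - analysis i (u n))).
  rewrite addrA subrK -addrA -opprD -big_split /=; congr (_ - _).
  by apply: eq_bigr => i _; rewrite -scalerDr addrC subrK.
apply: le_lt_trans (hnormD _ _) _; rewrite hnormN.
have := hnormD (K f - S (u n))
  (S (u n) - \sum_(i <- A) toK (w i) *: analysis i (u n)).
have := Su n; rewrite hnormBC.
move: hn; rewrite ltr_pdivlMr; last by rewrite mulr_gt0 //; lra.
have := e0 n; move: (e n) hT hA => en; lra.
Qed.

End AtomicSystems.

Theorem theorem14 (R : realType) (k : scalar_kind) (H : hilbertType R k)
    (H_separable : separable H) (I : countType)
    (K : H -> H) (K_bounded : bounded_operator K)
    (W : I -> set H) (w : I -> R) (W_bessel : bessel_fusion_sequence W w) :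
  atomic_system K W w <->
  bounded_quotient (adjoint K) (sqrt_operator (frame_operator W w)).
Proof.
have [B B0 BP] := bessel_bound W_bessel.
have [[[Qlin _] _ _] _] := sqrt_operatorP (frame_positive W_bessel B0 BP).
have [[Klin _] _] := adjointP K_bounded.
rewrite bounded_quotientP //; split=> [|[M M0 KM]].
  exact: atomic_system_dominated.
exact: dominated_atomic_system KM.
Qed.
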